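(* Let $X$ be a Banach space, let $T \in \mathscr{L}(X)$ and $(\gamma_n)_{n \geq 0} \subset \mathbb{C}^*$ be given, and let $\mathscr{F}$ be a Furstenberg family. Suppose that there exist a dense subset $\mathcal{D}$ of $X$, maps $S_n \colon \mathcal{D} \to X$, $n \geq 0$, and pairwise disjoint sets $A_k \in \mathscr{F}$, $k \geq 1$, satisfying the following conditions for each $y \in \mathcal{D}$: (I) There exists $k_0 \geq 1$ such that $\sum_{n=0}^{\infty} \mathbf{1}_{A_k}(n)\, \gamma_n\, S_n y$ converges unconditionally in $X$, uniformly in $k \geq k_0$. (II) For all $k_0 \in \mathbb{N}$ and $\varepsilon > 0$, there exists $k \geq k_0$ such that $$\Bigl\|\sum_{n \in F} \frac{\gamma_n}{\gamma_q} T^q S_n y\Bigr\| \leq \varepsilon \quad \text{if } F \subset A_k \text{ is finite and } q \in \Bigl(\bigcup_{\ell \geq 1} A_\ell\Bigr) \setminus F,$$ and further, for any $\delta > 0$, there exists $\ell_0 \geq 1$ such that $$\Bigl\|\sum_{n \in F} \frac{\gamma_n}{\gamma_q} T^q S_n y\Bigr\| \leq \delta \quad \text{if } F \subset A_k \text{ is finite and } q \in \Bigl(\bigcup_{\ell \geq \ell_0} A_\ell\Bigr) \setminus F.$$ (III) $\sup_{q \in A_k} \|T^q S_q y - y\| \to 0$ as $k \to +\infty$. Then $T$ is $\mathscr{F}_{\Gamma^{-1}}$-hypercyclic, where $\Gamma = \{\gamma_n : n \in \mathbb{N}_0\}$.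
   Context: $\mathbb{N}=\{1,2,\dots\}$, $\mathbb{N}_0=\mathbb{N}\cup\{0\}$, $\mathbb{C}^*=\mathbb{C}\setminus\{0\}$. All Banach spaces are complex, separable and infinite-dimensional; $\mathscr{L}(X)$ is the space of bounded linear operators on $X$. The maps $S_n$ are not assumed linear or continuous. A Furstenberg family is a family $\mathscr{F}$ of subsets of $\mathbb{N}_0$ with $\emptyset\notin\mathscr{F}\neq\emptyset$ that is hereditarily upward: if $E\subset F\subset\mathbb{N}_0$ and $E\in\mathscr{F}$, then $F\in\mathscr{F}$. For $\Gamma\subset\mathbb{C}$, $x\in X$ and $U\subset X$ put $\mathcal{N}_T(\Gamma x,U):=\{n\in\mathbb{N}_0: T^n(\Gamma x)\cap U\neq\emptyset\}$, where $\Gamma x=\{\lambda x:\lambda\in\Gamma\}$. $T$ is $\mathscr{F}_\Gamma$-hypercyclic if there is $x\in X$ such that $\mathcal{N}_T(\Gamma x,U)\in\mathscr{F}$ for every non-empty open set $U\subset X$. For $\Gamma\subset\mathbb{C}^*$, $\Gamma^{-1}:=\{a^{-1}:a\in\Gamma\}$. $\mathbf{1}_A$ is the indicator function of $A\subset\mathbb{N}_0$. For a non-empty index set $I$ and vectors $x_{n,k}\in X$ ($n\in\mathbb{N}_0$, $k\in I$), the series $\sum_{n=0}^\infty x_{n,k}$, $k\in I$, are said to be unconditionally convergent uniformly in $k\in I$ if for every $\varepsilon>0$ there is $N\geq1$ such that $\|\sum_{n\in F}x_{n,k}\|<\varepsilon$ for every $k\in I$ and every finite set $F\subset[N,\infty)$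 (of integers). *)

(* Defs.v *)
From HB Require Import structures.
From mathcomp Require Import all_boot all_order all_algebra.
From mathcomp Require Export complex.
From mathcomp Require Import all_classical all_reals all_analysis.

Set Implicit Arguments.
Unset Strict Implicit.
Unset Printing Implicit Defensive.

Import Order.TTheory GRing.Theory Num.Theory.
Import numFieldNormedType.Exports.

Local Open Scope classical_set_scope.
Local Open Scope ring_scope.

(* The complex field is [R[i]] for [R : realType]. Norms take values in [R[i]],
   where [0 < e] holds exactly when [e] is a positive real number. *)

Definition separable_space (X : topologicalType) : Prop :=
  exists2 D : set X, countable D & dense D.

Definition infinite_dimensional (K : fieldType) (X : lmodType K) : Prop :=
  forall (n : nat) (e : 'I_n -> X),
    exists x : X, forall c : 'I_n -> K, x <> \sum_(i < n) c i *: e i.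

Record furstenberg_family (F : set (set nat)) : Prop := FurstenbergFamily {
  furstenberg_set0 : ~ F set0;
  furstenberg_neq0 : F !=set0;
  furstenberg_upward : forall E G : set nat, E `<=` G -> F E -> F G
}.

Definition return_set (K : numFieldType) (X : normedModType K) (T : X -> X)
    (Gamma : set K) (x : X) (U : set X) : set nat :=
  [set n | (iter n T @` [set l *: x | l in Gamma]) `&` U !=set0].

Definition hypercyclic (K : numFieldType) (X : normedModType K)
    (F : set (set nat)) (Gamma : set K) (T : X -> X) : Prop :=
  exists x : X, forall U : set X,
    open U -> U !=set0 -> F (return_set T Gamma x U).

Definition unconditionally_cvg_uniformly (K : numFieldType)
    (X : normedModType K) (J : Type) (I : set J) (x : nat -> J -> X) : Prop :=
  forall e : K, 0 < e ->
    exists2 N : nat, (1 <= N)%N &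
      forall (k : J) (F : set nat), I k -> finite_set F ->
        F `<=` [set n | (N <= n)%N] -> `|\sum_(n \in F) x n k| < e.

(* Main.v *)
Require Import Defs.
From mathcomp Require Import all_boot all_order all_algebra.
From mathcomp Require Import all_classical all_reals all_analysis.
From mathcomp Require Import ring.
Import Order.TTheory GRing.Theory Num.Theory.
Import numFieldNormedType.Exports.
Set Implicit Arguments.
Unset Strict Implicit.
Local Open Scope classical_set_scope.
Local Open Scope ring_scope.

(** The orbit of a single vector is to meet every non-empty open set along one
    whole set [A k].  Choose vectors [y j] in [D] such that every non-empty open
    set contains [y j] for arbitrarily large [j] ([dense_seq_often]), indices
    [k 0 < k 1 < ...], and put

      [x = sum_j sum_(n in A (k j)) gamma n *: S n (y j)].

    Fix [q] in [A (k j)] and apply [(gamma q)^-1 *: T^q] to [x].  The entry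
    [(j, q)] of the double series becomes [T^q (S q (y j))], which is close to
    [y j] by condition (III).  All the other entries are errors, and by
    disjointness of the [A k] none of them has index [n = q], so condition (II)
    applies to them.  The block [i] contributes

    - at most [2^-(i+1)] if [i >= j], by the first half of (II), whatever [q] is;
    - at most [2^-(i+1) * 2^-j] if [i < j], by the second half of (II), as soon
      as [k j] is large in terms of the blocks already chosen.

    The sum of these errors is at most [2 * 2^-j] ([sum_hpow_le]).  Hence
    [(gamma q)^-1 *: T^q x] is within [3 * 2^-j] of [y j] for every [q] in
    [A (k j)], so the return set of any open set contains some [A (k j)].

    The indices [k j] are built by a recursion in which each choice imposes lower
    bounds on all the later ones ([stagewise_choice]).  The double series
    converges because of (I): disjoint sets eventually leave every [0, N)
    ([disjoint_eventually_ge]), so for large [k] a block along [A k] only sees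
    the tail of its series, and the uniformity in [k] makes all its finite
    partial sums at most [2^-(j+1)] ([cvg_square_partial_sums]). *)

(** * Powers of one half *)

Local Notation hpow n := (2%:R^-1 ^+ n).

Lemma hpow_gt0 (K : numFieldType) n : 0 < hpow n :> K.
Proof. by rewrite exprn_gt0 // invr_gt0 ltr0n. Qed.

Lemma hpow_double (K : numFieldType) n : hpow n = hpow n.+1 + hpow n.+1 :> K.
Proof. by rewrite exprS mulrC -splitr. Qed.

(** [0 < e] in [R[i]] forces [e] to be real, so this is the archimedean property
    of [R]. *)
Lemma hpow_lt (R : realType) (e : R[i]) : 0 < e ->
  exists N, forall n, (N <= n)%N -> hpow n < e.
Proof.
move=> e0; have Ree : e = (complex.Re e)%:C%C.
  by rewrite RRe_real // gtr0_real.
have r0 : 0 < complex.Re e by rewrite -ltcR -Ree.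
exists (Num.bound (complex.Re e)^-1) => n Nn.
have -> : hpow n = (hpow n : R)%:C%C by rewrite rmorphXn fmorphV rmorph_nat.
rewrite Ree ltcR exprVn invf_plt ?posrE ?exprn_gt0//.
apply: lt_le_trans (archi_boundP _) _; first by rewrite invr_ge0 ltW.
rewrite -natrX ler_nat; apply: leq_trans Nn _; exact: ltnW (ltn_expl _ _).
Qed.

(** The budget of the proof: block [i] is allowed the error [2^-(i+1)], damped by
    a factor [e] for the blocks before [J].  The weights add up to less than 1, and
    to less than [2^-J] from [J] on, whatever [M] is.  It serves both for the convergence of the
    double series and for the error in the orbit. *)
Lemma sum_hpow_le (K : numFieldType) (e : K) (J M : nat) : 0 <= e ->
  \sum_(i < M) (if (i < J)%N then hpow i.+1 * e else hpow i.+1) <= e + hpow J.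
Proof.
move=> e0; pose f (i : nat) : K := if (i < J)%N then hpow i.+1 * e else hpow i.+1.
change (\sum_(i < M) f i <= e + hpow J).
have le_add (a b c : K) : 0 <= c -> a + c = b -> a <= b.
  by move=> c0 <-; rewrite lerDl.
have sumJ m : (m <= J)%N -> \sum_(i < m) f i = e * (1 - hpow m).
  elim: m => [|m IH] mJ; first by rewrite big_ord0 expr0 subrr mulr0.
  by rewrite big_ord_recr /= IH 1?ltnW// /f mJ hpow_double; ring.
have [MJ|JM] := leqP M J.
  rewrite sumJ//; apply: (le_add _ _ (e * hpow M + hpow J)); last by ring.
  by rewrite addr_ge0 ?mulr_ge0// ltW// hpow_gt0.
have -> : \sum_(i < M) f i = e * (1 - hpow J) + hpow J - hpow M.
  move/ltnW: JM; elim: M => [|m IH].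
    by rewrite leqn0 => /eqP ->; rewrite big_ord0 expr0; ring.
  rewrite leq_eqVlt => /predU1P[<-|]; first by rewrite sumJ//; ring.
  rewrite ltnS => Jm; rewrite big_ord_recr /= IH// /f ltnNge Jm /=.
  by rewrite (hpow_double _ m); ring.
apply: (le_add _ _ (e * hpow J + hpow M)); last by ring.
by rewrite addr_ge0 ?mulr_ge0// ltW// hpow_gt0.
Qed.

(** * Double series *)

Lemma big_ord_fsbig (V : zmodType) (f : nat -> V) M (p : pred nat) :
  \sum_(n < M | p n) f n = \sum_(n \in [set n | (n < M)%N /\ p n]) f n.
Proof.
rewrite big_mkcond /= (fsbig_ord _ _ (fun n => if p n then f n else 0)).
have -> : [set n | (n < M)%N /\ p n] = `I_M `&` [set` p] by [].
rewrite fsbig_mkcondr; apply: eq_fsbigr => n _; congr (if _ then _ else _).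
by rewrite mem_setE.
Qed.

Lemma finite_set_ord M (p : pred nat) : finite_set [set n | (n < M)%N /\ p n].
Proof.
by apply: (@sub_finite_set _ _ `I_M); [move=> n [] | exact: finite_II].
Qed.

(** The partial sums over the squares [0, M) x [0, M) are Cauchy: what lies outside
    a large square splits into full or tail pieces of each row.  For the finitely
    many rows before [J] these are tails, hence small; the remaining rows are
    controlled by the weights.  Allowing an arbitrary predicate [p] in the
    hypotheses expresses unconditional smallness of the row sums. *)
Lemma cvg_square_partial_sums (R : realType) (X : completeNormedModType R[i])
    (u : nat -> nat -> X) :
  (forall i M (p : pred nat), `|\sum_(n < M | p n) u i n| <= hpow i.+1) ->
  (forall i e, 0 < e -> exists N, forall M (p : pred nat),
     (forall n, p n -> (N <= n)%N) -> `|\sum_(n < M | p n) u i n| <= e) ->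
  cvgn (fun M => \sum_(i < M) \sum_(n < M) u i n).
Proof.
move=> u_le u_small; apply: cauchy_cvg; apply: cauchy_exP => e e0.
have e20 : 0 < e / 2 by rewrite divr_gt0.
have [J /(_ J (leqnn J)) Je] := hpow_lt e20.
have [N N_le] := choice (fun i => u_small i _ (mulr_gt0 (hpow_gt0 _ i.+1) e20)).
(* [N0 >= J] matters: in the rows before [J] only the indices [n >= N0] remain
   outside the square. *)
pose N0 := maxn J (\max_(i < J) N i).
exists (\sum_(i < N0) \sum_(n < N0) u i n).
suff : \forall M \near \oo, ball (\sum_(i < N0) \sum_(n < N0) u i n) e
    (\sum_(i < M) \sum_(n < M) u i n) by [].
near=> M.
have N0M : (N0 <= M)%N by near: M; exact: nbhs_infty_ge.
pose c (i n : nat) := (i < N0)%N && (n < N0)%N.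
have E : \sum_(i < N0) \sum_(n < N0) u i n
    = \sum_(i < M) \sum_(n < M | c i n) u i n.
  rewrite (big_ord_widen M (fun i => \sum_(n < N0) u i n) N0M) big_mkcond /=.
  apply: eq_bigr => i _; rewrite /c; case: ifP => iN /=.
    by rewrite (big_ord_widen M (u i) N0M).
  by rewrite big_pred0.
rewrite -ball_normE /= distrC {}E -sumrB.
under eq_bigr => i _ do
  rewrite (bigID (fun n : 'I_M => c i n)) /= addrAC subrr add0r.
apply: le_lt_trans (ler_norm_sum _ _ _) _.
apply: (@le_lt_trans _ _ (\sum_(i < M)
    (if (i < J)%N then hpow i.+1 * (e / 2) else hpow i.+1))).
  apply: ler_sum => i _; case: ifPn => [iJ|_]; last first.
    exact: (u_le i M (fun n => ~~ c i n)).
  apply: (N_le i M (fun n => ~~ c i n)) => n.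
  rewrite /c (leq_trans iJ (leq_maxl _ _)) /= -leqNgt; apply: leq_trans.
  by rewrite leq_max (leq_bigmax (Ordinal iJ)) orbT.
rewrite [ltRHS]splitr.
by apply: le_lt_trans (sum_hpow_le _ _ (ltW e20)) _; rewrite ltrD2l.
Unshelve. all: by end_near. Qed.

(** Isolates the main entry [(j, q)]: disjointness of the rows guarantees that
    removing [q] from every row removes nothing else. *)
Lemma sum_remove_entry (V : zmodType) (a : nat -> pred nat)
    (v : nat -> nat -> V) (j q M : nat) :
  (j < M)%N -> (q < M)%N -> a j q -> (forall i, a i q -> i = j) ->
  \sum_(i < M) \sum_(n < M | a i n) v i n =
  v j q + \sum_(i < M) \sum_(n < M | a i n && (n != q :> nat)) v i n.
Proof.
move=> jM qM ajq a_uniq.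
rewrite (bigD1 (Ordinal jM)) //= [in RHS](bigD1 (Ordinal jM)) //= addrA.
congr (_ + _); first by rewrite (bigD1 (Ordinal qM)).
apply: eq_bigr => i ij; apply: eq_bigl => n.
case: (boolP (a i n)) => //= ain; case: eqP => // nq.
by rewrite -val_eqE /= (a_uniq i) ?eqxx // -nq in ij.
Qed.

(** * Choice of the indices and of the vectors *)

(** Each of the finitely many [n < N] belongs to at most one of the sets. *)
Lemma disjoint_eventually_ge (A : nat -> set nat) :
  (forall k l, (1 <= k)%N -> (1 <= l)%N -> k <> l -> A k `&` A l = set0) ->
  forall N, exists K, forall k n, (K <= k)%N -> A k n -> (N <= n)%N.
Proof.
move=> A_disj; elim=> [|N [K K_ge]]; first by exists 0%N.
have [[l [l1 AlN]]|no] := pselect (exists l, (1 <= l)%N /\ A l N).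
  exists (maxn K l.+1) => k n; rewrite geq_max => /andP[Kk lk] Akn.
  rewrite ltn_neqAle (K_ge k)// andbT; apply/eqP => Nn.
  have kl : k <> l by move=> kl; rewrite kl ltnn in lk.
  suff : (A k `&` A l) n by rewrite A_disj//; exact: leq_trans lk.
  by split=> //; rewrite -Nn.
exists (maxn K 1) => k n; rewrite geq_max => /andP[Kk k1] Akn.
rewrite ltn_neqAle (K_ge k)// andbT; apply/eqP => Nn.
by apply: no; exists k; rewrite Nn.
Qed.

(** Choices of [k j] by recursion on [j], where [P j] holds for arbitrarily large
    indices and every admissible [k i] makes [Q] hold for all large enough later
    indices.  Instead of the list of previous choices, the recursion carries the
    function [B i] of lower bounds that the choices before stage [i] impose on
    every stage. *)
Lemma stagewise_choice (P : nat -> nat -> Prop)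
    (Q : nat -> nat -> nat -> nat -> Prop) :
  (forall j K, exists2 k, (K <= k)%N & P j k) ->
  (forall i k j, P i k -> exists L, forall l, (L <= l)%N -> Q i k j l) ->
  exists2 k : nat -> nat, forall j, P j (k j) &
    forall i j, (i < j)%N -> Q i (k i) j (k j).
Proof.
move=> P_often Q_ev.
have exg (jK : nat * nat) : exists k, (jK.2 <= k)%N /\ P jK.1 k.
  by have [k] := P_often jK.1 jK.2; exists k.
have exL (t : nat * nat * nat) : exists L,
    P t.1.1 t.1.2 -> forall l, (L <= l)%N -> Q t.1.1 t.1.2 t.2 l.
  case: t => -[i k] j /=.
  have [Pik|nP] := pselect (P i k); last by exists 0%N.
  by have [L L_] := Q_ev i k j Pik; exists L.
have [[g g_] [L L_]] := (choice exg, choice exL).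
pose step (i : nat) (B : nat -> nat) (j : nat) :=
  maxn (B j) (L (i, g (i, B i), j)).
pose B := fix B (i : nat) := if i is i'.+1 then step i' (B i') else fun=> 0%N.
have B_mono j i i' : (i <= i')%N -> (B i j <= B i' j)%N.
  move=> /subnK <-; elim: (i' - i)%N => // d IH.
  by apply: leq_trans IH _; exact: leq_maxl.
exists (fun j => g (j, B j j)) => [j|i j ij]; first exact: (g_ (j, B j j)).2.
apply: (L_ (i, g (i, B i i), j)); first exact: (g_ (i, B i i)).2.
apply: leq_trans (g_ (j, B j j)).1; apply: leq_trans (B_mono _ _ _ ij).
exact: leq_maxr.
Qed.

(** Let [d] enumerate a countable dense set.  Since [j |-> logn 2 j] takes each
    value at arbitrarily large [j] (at [j = 2^m * 3^r]), it is enough to take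
    [z j] in [D] within [2^-j] of [d (logn 2 j)]. *)
Lemma dense_seq_often (R : realType) (X : normedModType R[i]) (D : set X) :
  separable_space X -> dense D ->
  exists y : nat -> set_type D, forall (x : X) (e : R[i]) N, 0 < e ->
    exists2 j, (N <= j)%N & `|\val (y j) - x| < e.
Proof.
move=> [D0 cD0 dD0] dD.
have D0_neq0 : D0 !=set0.
  have [|x [_ D0x]] := dD0 setT _ openT; first by exists 0.
  by exists x.
have [d dE] : exists d : nat -> X, forall x, D0 x -> exists m, d m = x.
  have /pfcard_geP[D00|/unsquash f] := cD0.
    by move: D0_neq0; rewrite D00 => -[].
  exists f => x /(@surj _ _ _ _ f)[m _ fm].
  by exists m.
have near_D (x : X) (e : R[i]) : 0 < e -> exists z : set_type D, `|\val z - x| < e.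
  move=> e0; have [||z [xz Dz]] := dD (ball x e).
  - by exists x; exact: ballxx.
  - exact: ball_open.
  exists (SigSub (mem_set Dz)); rewrite distrC.
  by move: xz; rewrite -ball_normE.
have [z z_] := choice (fun j => near_D (d (logn 2 j)) _ (hpow_gt0 _ j)).
exists z => x e N e0.
have e20 : 0 < e / 2 by rewrite divr_gt0.
have [||w [xw /dE[m dm]]] := dD0 (ball x (e / 2)).
- by exists x; exact: ballxx.
- exact: ball_open.
have [N1 N1_] := hpow_lt e20.
pose j := (2 ^ m * 3 ^ (maxn N N1))%N.
have jm : logn 2 j = m.
  by rewrite lognM ?expn_gt0// pfactorK// lognX logn_coprime// muln0 addn0.
have le_j : (maxn N N1 <= j)%N.
  apply: leq_trans (ltnW (ltn_expl _ (isT : 1 < 3)%N)) _.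
  by rewrite leq_pmull ?expn_gt0.
move: le_j; rewrite geq_max => /andP[Nj N1j].
exists j => //; apply: le_lt_trans (ler_distD (d m) _ _) _.
rewrite [ltRHS]splitr ltrD//; last first.
  by rewrite dm distrC; move: xw; rewrite -ball_normE.
by rewrite -{1}jm; apply: lt_trans (z_ j) _; exact: N1_.
Qed.

(** * Iterates of an operator *)

Lemma iter_linear_sum (K : pzRingType) (X : lmodType K)
    (T : {linear X -> X}) q M (f : 'I_M -> X) :
  iter q T (\sum_(i < M) f i) = \sum_(i < M) iter q T (f i).
Proof. by elim: q => //= q ->; rewrite linear_sum. Qed.

Lemma iter_linearZ (K : pzRingType) (X : lmodType K) (T : {linear X -> X}) q
    (c : K) (x : X) :
  iter q T (c *: x) = c *: iter q T x.
Proof. by elim: q => //= q ->; rewrite linearZ. Qed.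

Lemma iter_continuous (X : topologicalType) (f : X -> X) q :
  continuous f -> continuous (iter q f).
Proof.
move=> cf; elim: q => [|q IH] x; first exact: cvg_id.
exact: (continuous_comp (IH x) (cf _)).
Qed.

(** * Hypercyclicity *)

Theorem theorem3p2 (R : realType) (X : completeNormedModType R[i])
  (sepX : separable_space X) (infX : infinite_dimensional X)
  (T : {linear X -> X}) (bT : bounded_near T (nbhs (0 : X)))
  (gamma : nat -> R[i]) (gamma_neq0 : forall n, gamma n != 0)
  (FF : set (set nat)) (FF_furstenberg : furstenberg_family FF)
  (D : set X) (denseD : dense D)
  (S : nat -> set_type D -> X)
  (A : nat -> set nat)
  (A_FF : forall k, (1 <= k)%N -> FF (A k))
  (A_disj : forall k l, (1 <= k)%N -> (1 <= l)%N -> k <> l ->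
    A k `&` A l = set0)
  (condI : forall y : set_type D,
    exists2 k0 : nat, (1 <= k0)%N &
      unconditionally_cvg_uniformly [set k | (k0 <= k)%N]
        (fun n k => \1_(A k) n *: (gamma n *: S n y)))
  (condII : forall (y : set_type D) (k0 : nat) (eps : R[i]),
    (1 <= k0)%N -> 0 < eps ->
    exists2 k : nat, (k0 <= k)%N &
      (forall (F : set nat) (q : nat), finite_set F -> F `<=` A k ->
         ((\bigcup_(l in [set l | (1 <= l)%N]) A l) `\` F) q ->
         `|\sum_(n \in F) (gamma n / gamma q) *: iter q T (S n y)| <= eps) /\
      (forall delta : R[i], 0 < delta ->
         exists2 l0 : nat, (1 <= l0)%N &
           forall (F : set nat) (q : nat), finite_set F -> F `<=` A k ->
             ((\bigcup_(l in [set l | (l0 <= l)%N]) A l) `\` F) q ->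
             `|\sum_(n \in F) (gamma n / gamma q) *: iter q T (S n y)|
               <= delta))
  (condIII : forall y : set_type D,
    (fun k : nat =>
       ereal_sup [set (complex.Re `|iter q T (S q y) - \val y|)%:E
                 | q in A k]) @ \oo --> (0 : \bar R)%E) :
  hypercyclic FF [set a^-1 | a in range gamma] T.
Proof.
have cT : continuous T by apply/linear_bounded_continuous.
have [y y_often] := dense_seq_often sepX denseD.
pose term (z : set_type D) q n := (gamma n / gamma q) *: iter q T (S n z).
have III (z : set_type D) (e : R[i]) : 0 < e -> exists K, forall k q,
    (K <= k)%N -> A k q -> `|iter q T (S q z) - \val z| <= e.
  move=> e0; have Ree : e = (complex.Re e)%:C%C.
    by rewrite RRe_real // gtr0_real.
  have r0 : 0 < complex.Re e by rewrite -ltcR -Ree.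
  have /(condIII z)[K _ K_lt] : nbhs (0 : \bar R)%E
      [set t | (t < (complex.Re e)%:E)%E].
    by apply: open_nbhs_nbhs; split; [exact: open_ereal_lt_ereal | rewrite /= lte_fin].
  exists K => k q Kk Akq.
  rewrite -[leLHS]RRe_real ?normr_real// Ree lecR -lee_fin.
  by apply: le_trans (ltW (K_lt k Kk)); apply: ereal_sup_ubound; exists q.
(* [good j k]: [A k] can serve as block [j]; the last clause is the promise of
   (II) used against the later blocks. *)
pose good j k := [/\ (1 <= k)%N,
  forall q, A k q -> `|iter q T (S q (y j)) - \val (y j)| <= hpow j.+1,
  (forall M (p : pred nat),
     `|\sum_(n < M | p n) \1_(A k) (n : nat) *: (gamma n *: S n (y j))|
       <= hpow j.+1) /\
  (forall e, 0 < e -> exists N, forall M (p : pred nat),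
     (forall n, p n -> (N <= n)%N) ->
     `|\sum_(n < M | p n) \1_(A k) (n : nat) *: (gamma n *: S n (y j))| <= e),
  forall (F : set nat) q, finite_set F -> F `<=` A k ->
    ((\bigcup_(l in [set l | (1 <= l)%N]) A l) `\` F) q ->
    `|\sum_(n \in F) term (y j) q n| <= hpow j.+1 &
  forall d : R[i], 0 < d -> exists2 l0, (1 <= l0)%N &
    forall (F : set nat) q, finite_set F -> F `<=` A k ->
      ((\bigcup_(l in [set l | (l0 <= l)%N]) A l) `\` F) q ->
      `|\sum_(n \in F) term (y j) q n| <= d].
pose small i k j l := (k < l)%N /\
  forall (F : set nat) q, finite_set F -> F `<=` A k -> A l q -> ~ F q ->
    `|\sum_(n \in F) term (y i) q n| <= hpow i.+1 * hpow j.
have good_often j K : exists2 k, (K <= k)%N & good j k.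
  have w0 : 0 < hpow j.+1 :> R[i] by exact: hpow_gt0.
  have [k0 k01 I_] := condI (y j).
  have [N N1 N_] := I_ _ w0.
  have [K1 K1_] := disjoint_eventually_ge A_disj N.
  have [K2 K2_] := III (y j) _ w0.
  (* Past [K1] the set [A k] avoids [0, N), so all of the block is a tail. *)
  have := condII (y j) (maxn (maxn K k0) (maxn K1 K2)) _ _ w0.
  case=> [|k]; first by rewrite !leq_max k01 orbT.
  rewrite !geq_max => /andP[/andP[Kk k0k] /andP[K1k K2k]] [II1 II2].
  exists k => //; split=> //; first exact: leq_trans k0k.
  - by move=> q; exact: K2_.
  - split=> [M p|e e0].
      rewrite (bigID (fun n : 'I_M => (N <= n)%N)) /= [X in _ + X]big1 ?addr0.
        rewrite (big_ord_fsbig (fun n => \1_(A k) n *: (gamma n *: S n (y j))) M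
          (fun n => p n && (N <= n)%N)).
        apply/ltW/(N_ k) => //; first exact: finite_set_ord.
        by move=> n [_ /andP[]].
      move=> n /andP[_ nN]; rewrite indicE memNset ?scale0r// => Akn.
      by rewrite (K1_ k n K1k Akn) in nN.
    have [N' N'1 N'_] := I_ _ e0.
    exists N' => M p pN'.
    rewrite (big_ord_fsbig (fun n => \1_(A k) n *: (gamma n *: S n (y j)))).
    apply/ltW/(N'_ k) => //; first exact: finite_set_ord.
    by move=> n [_ /pN'].
have small_ev i k j : good i k -> exists L, forall l, (L <= l)%N -> small i k j l.
  move=> [_ _ _ _ /(_ _ (mulr_gt0 (hpow_gt0 _ i.+1) (hpow_gt0 _ j)))[l0 _ l0_]].
  exists (maxn k.+1 l0) => l; rewrite geq_max => /andP[kl l0l]; split=> //.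
  by move=> F q finF FA Alq Fq; apply: l0_ => //; split=> //; exists l.
have [k Pk Qk] := stagewise_choice good_often small_ev.
have k_ge1 i : (1 <= k i)%N by have [] := Pk i.
have k_inj i j : i <> j -> k i <> k j.
  move=> /eqP; rewrite neq_ltn => /orP[] /Qk[+ _]; first by move=> /ltn_eqF/eqP.
  by move=> /gtn_eqF/eqP.
pose u i n := \1_(A (k i)) n *: (gamma n *: S n (y i)).
pose xs M := \sum_(i < M) \sum_(n < M) u i n.
have /cvg_ex[x xs_x] : cvgn xs.
  by apply: cvg_square_partial_sums => i; have [_ _ [u1 u2] _ _] := Pk i.
(* The estimate concerns the finite sums [xs M]; only the last step passes to the
   limit, so no infinite sum is ever rearranged. *)
have estimate j q M : A (k j) q -> (j < M)%N -> (q < M)%N ->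
    `|(gamma q)^-1 *: iter q T (xs M) - \val (y j)| <= hpow j *+ 3.
  move=> Akq jM qM.
  pose a i n := n \in A (k i).
  have E : (gamma q)^-1 *: iter q T (xs M)
      = \sum_(i < M) \sum_(n < M | a i n) term (y i) q n.
    rewrite iter_linear_sum scaler_sumr; apply: eq_bigr => i _.
    rewrite iter_linear_sum scaler_sumr [RHS]big_mkcond; apply: eq_bigr => n _.
    rewrite /u /a indicE iter_linearZ.
    case: (_ \in _); last by rewrite scale0r scaler0.
    by rewrite scale1r iter_linearZ scalerA mulrC.
  rewrite E (sum_remove_entry (fun i n => term (y i) q n) jM qM); last 2 first.
  - exact: mem_set.
  - move=> i /set_mem Aiq; apply: contrapT => /k_inj ij.
    suff : (A (k i) `&` A (k j)) q by rewrite A_disj.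
    by split.
  rewrite addrAC mulrS mulr2n.
  apply: le_trans (ler_normD _ _) _; apply: lerD.
    apply: (@le_trans _ _ (hpow j.+1)).
      2: by rewrite [leRHS]hpow_double lerDl ltW// hpow_gt0.
    by rewrite /term divff// scale1r; have [_ + _ _ _] := Pk j; exact.
  apply: le_trans (ler_norm_sum _ _ _) _.
  apply: le_trans (sum_hpow_le _ _ (ltW (hpow_gt0 _ j))).
  apply: ler_sum => i _.
  rewrite (big_ord_fsbig (fun n => term (y i) q n) M (fun n => a i n && (n != q))).
  set F := [set n | _].
  have FA : F `<=` A (k i) by move=> n [_ /andP[/set_mem]].
  have finF : finite_set F by exact: finite_set_ord.
  have Fq : ~ F q by move=> [_ /andP[_]]; rewrite eqxx.
  case: ifPn => [ij|_]; first by have [_] := Qk _ _ ij; exact.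
  have [_ _ _ + _] := Pk i; apply=> //; split=> //.
  by exists (k j); first exact: k_ge1.
exists x => U oU [z Uz].
have /nbhs_ballP[e /= e0 eU] : nbhs z U by exact: open_nbhs_nbhs.
have d0 : 0 < e / 3 by rewrite divr_gt0.
have [N N_] := hpow_lt (divr_gt0 d0 (ltr0n _ 3%N)).
have [j Nj yz] := y_often z _ N d0.
apply: (furstenberg_upward FF_furstenberg) (A_FF _ (k_ge1 j)) => q Aq /=.
exists (iter q T ((gamma q)^-1 *: x)); split.
  by exists ((gamma q)^-1 *: x) => //; exists (gamma q)^-1 => //; exists (gamma q).
apply: eU; rewrite -ball_normE /= iter_linearZ.
have cvg_q : (gamma q)^-1 *: iter q T (xs M) @[M --> \oo]
    --> (gamma q)^-1 *: iter q T x.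
  apply: cvgZl_tmp; apply: (continuous_cvg _ _ xs_x).
  exact: iter_continuous.
have [M []] : exists M, (maxn j q < M)%N /\
    `|(gamma q)^-1 *: iter q T x - (gamma q)^-1 *: iter q T (xs M)| < e / 3.
  near (\oo : set_system nat) => M; exists M; split; near: M.
    exact: nbhs_infty_gt.
  by move/cvgrPdist_lt : cvg_q; exact.
rewrite gtn_max => /andP[jM qM] xM.
have -> : e = e / 3 + e / 3 + e / 3.
  by field.
apply: le_lt_trans (ler_distD ((gamma q)^-1 *: iter q T (xs M)) _ _) _.
rewrite ltrD//; last by rewrite distrC.
apply: le_lt_trans (ler_distD (\val (y j)) _ _) _.
rewrite ltrD//; first by rewrite distrC.
rewrite distrC; apply: le_lt_trans (estimate _ _ _ Aq jM qM) _.
by rewrite -mulr_natr -ltr_pdivlMr// N_.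
Unshelve. all: by end_near. Qed.
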